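(* Let $A$ and $N$ be abelian groups and let $\omega\in Z^3(A,N)$ be such that $[\alpha_\omega(a\|-,-)]=0$ in $H^2(A,N)$ for all $a\in A$. Then there exists $c:A\times A\to N$ such that $(\omega,c)\in Z^3_{ab}(A,N)$ if and only if $\theta(\omega)=0$ in $\mathrm{Ext}^1_{\mathbb{Z}}(A,\mathrm{Hom}(A,N))$.
   Context: Groups are written additively; $A$ acts trivially on $N$. $Z^n(A,N)$ and $H^n(A,N)$ denote inhomogeneous group cocycles (normalized: vanishing when some argument is $0$) and group cohomology. For $\omega\in Z^3(A,N)$ put $\alpha_\omega(x\|y,z)=\omega(x,y,z)-\omega(y,x,z)+\omega(y,z,x)$ and $\beta_\omega(x,y\|z)=\omega(x,y,z)-\omega(x,z,y)+\omega(z,x,y)$; for each $a\in A$, $\alpha_\omega(a\|-,-)\in Z^2(A,N)$. $Z^3_{ab}(A,N)$ is the set of pairs $(\omega,c)$, $\omega:A^3\to N$, $c:A\times A\to N$, such that for all $x,y,z,t\in A$: (i) $\omega(y,z,t)-\omega(x+y,z,t)+\omega(x,y+z,t)-\omega(x,y,z+t)+\omega(x,y,z)=0$; (ii) $c(x,z)-c(x,y+z)+c(x,y)+\alpha_\omega(x\|y,z)=0$; (iii) $c(y,z)-c(x+y,z)+c(x,z)-\beta_\omega(x,y\|z)=0$. For a map $\eta:A\times A\to N$, $(x,y)\mapsto\eta(x\|y)$, let $\delta_h(\eta)(x,y\|z)=\eta(y\|z)-\eta(x+y\|z)+\eta(x\|z)$ and $\delta_v(\eta)(x\|y,z)=\eta(x\|z)-\eta(x\|y+z)+\eta(x\|y)$.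 Definition of $\theta(\omega)$: if $[\alpha_\omega(a\|-,-)]=0$ in $H^2(A,N)$ for all $a\in A$, there is a map $\eta:A\times A\to N$ with $\delta_v(\eta)=\alpha_\omega$. Then $\theta(\omega,\eta):=\delta_h(\eta)+\beta_\omega$ is additive in its last variable and defines a symmetric 2-cocycle $A\times A\to\mathrm{Hom}(A,N)$, $(x,y)\mapsto\theta(\omega,\eta)(x,y\|-)$. Its class in the group of symmetric 2-cocycles $A\times A\to \mathrm{Hom}(A,N)$ modulo the coboundaries $(x,y)\mapsto l(y)-l(x+y)+l(x)$, $l:A\to\mathrm{Hom}(A,N)$ any map, i.e. in $H^2_{ab}(A,\mathrm{Hom}(A,N))=\mathrm{Ext}^1_{\mathbb{Z}}(A,\mathrm{Hom}(A,N))$, does not depend on the choice of $\eta$; it is denoted $\theta(\omega)$. *)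

(* Defs.v *)
From HB Require Import structures.
From mathcomp Require Import all_boot all_algebra ring_quotient.
From mathcomp Require Import boolp functions.

Set Implicit Arguments.
Unset Strict Implicit.
Unset Printing Implicit Defensive.

Import GRing.Theory.
Local Open Scope ring_scope.
Local Open Scope quotient_scope.

Module ZmodTac.

Inductive expr := Var of nat | Zero | Add of expr & expr | Opp of expr.

Fixpoint eval (V : zmodType) (l : seq V) (e : expr) : V :=
  match e with
  | Var i => l`_i
  | Zero => 0
  | Add e1 e2 => eval l e1 + eval l e2
  | Opp e1 => - eval l e1
  end.

Fixpoint coef (e : expr) (i : nat) : int :=
  match e with
  | Var j => if i == j then 1 else 0
  | Zero => 0
  | Add e1 e2 => coef e1 i + coef e2 i
  | Opp e1 => - coef e1 i
  end.

Lemma evalE (V : zmodType) (l : seq V) e :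
  eval l e = \sum_(i < size l) l`_i *~ coef e i.
Proof.
elim: e => [j||e1 IH1 e2 IH2|e1 IH1] /=.
- have [jl|lj] := ltnP j (size l).
    rewrite (bigD1 (Ordinal jl)) //= eqxx mulr1z big1 ?addr0 // => i.
    by rewrite -val_eqE /= => /negbTE ->.
  rewrite nth_default // big1 // => i _; rewrite ifN //.
  by apply: contraTneq (ltn_ord i) => ->; rewrite -leqNgt.
- by rewrite big1.
- by rewrite IH1 IH2 -big_split; apply: eq_bigr => i _; rewrite mulrzDr.
- by rewrite IH1 -sumrN; apply: eq_bigr => i _; rewrite mulrNz.
Qed.

Lemma correct (V : zmodType) (l : seq V) e1 e2 :
  all (fun i => coef e1 i == coef e2 i) (iota 0 (size l)) ->
  eval l e1 = eval l e2.
Proof.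
move=> /allP h; rewrite !evalE; apply: eq_bigr => i _; congr (_ *~ _).
by apply/eqP/h; rewrite mem_iota add0n ltn_ord.
Qed.

Ltac mem x l :=
  match l with
  | nil => false
  | ?y :: _ => let _ := match constr:(Set) with _ => unify x y end in true
  | _ :: ?l' => mem x l'
  end.

Ltac atoms t l :=
  lazymatch t with
  | (?a + ?b)%R => let l' := atoms a l in atoms b l'
  | (- ?a)%R => atoms a l
  | 0%R => l
  | _ => match mem t l with true => l | false => constr:(t :: l) end
  end.

Ltac idx x l :=
  match l with
  | ?y :: ?l' => let _ := match constr:(Set) with _ => unify x y end in
                 constr:(0%N)
  | ?y :: ?l' => let i := idx x l' in constr:(S i)
  end.

Ltac reify t l :=
  lazymatch t with
  | (?a + ?b)%R => let e1 := reify a l in let e2 := reify b l in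
                   constr:(Add e1 e2)
  | (- ?a)%R => let e := reify a l in constr:(Opp e)
  | 0%R => constr:(Zero)
  | _ => let i := idx t l in constr:(Var i)
  end.

Ltac zmod :=
  lazymatch goal with
  | |- @eq ?T ?s ?t =>
    let l := atoms s (@nil T) in
    let l := atoms t l in
    let e1 := reify s l in
    let e2 := reify t l in
    refine (@correct _ l e1 e2 _); by vm_compute
  end.

End ZmodTac.

(* Closes equations that hold in every abelian group, by reflection. *)
Ltac zmod := ZmodTac.zmod.

Section GroupCohomology.
Variables A N : zmodType.

Record Z3 := MkZ3 {
  Z3_fun :> A -> A -> A -> N;
  Z3_norm : forall x y,
    [/\ Z3_fun 0 x y = 0, Z3_fun x 0 y = 0 & Z3_fun x y 0 = 0];
  Z3_cocycle : forall x y z t,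
    Z3_fun y z t - Z3_fun (x + y) z t + Z3_fun x (y + z) t
      - Z3_fun x y (z + t) + Z3_fun x y z = 0 }.

Definition is_Z2 (f : A -> A -> N) : Prop :=
  (forall x, f x 0 = 0 /\ f 0 x = 0) /\
  (forall x y z, f y z - f (x + y) z + f x (y + z) - f x y = 0).

Definition Z2_pred : {pred A -> A -> N} := fun f => `[< is_Z2 f >].

Lemma Z2_pred_zmod_closed : zmod_closed Z2_pred.
Proof.
split=> [|f g /asboolP[nf cf] /asboolP[ng cg]]; apply/asboolP; split=> /=.
- by [].
- by move=> x y z; rewrite -[LHS]/(0 - 0 + 0 - 0 : N); zmod.
- by move=> x; have [f1 f2] := nf x; have [g1 g2] := ng x; rewrite !fctE f1 f2 g1 g2 subrr.
- move=> x y z; rewrite !fctE -[RHS](subrr 0) -{1}(cf x y z) -(cg x y z).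
  by zmod.
Qed.
HB.instance Definition _ :=
  GRing.isZmodClosed.Build (A -> A -> N) Z2_pred Z2_pred_zmod_closed.

Record Z2 := MkZ2 { Z2_fun :> A -> A -> N; Z2P : Z2_fun \in Z2_pred }.
HB.instance Definition _ := [isSub for Z2_fun].
HB.instance Definition _ := [Choice of Z2 by <:].
HB.instance Definition _ := [SubChoice_isSubZmodule of Z2 by <:].

Lemma Z20E x y : (0 : Z2) x y = 0.
Proof. by rewrite -[Z2_fun _]/(val _) raddf0. Qed.

Lemma Z2BE (f g : Z2) x y : (f - g) x y = f x y - g x y.
Proof. by rewrite -[Z2_fun _]/(val _) raddfB. Qed.

Definition B2 : {pred Z2} := fun f =>
  `[< exists2 g : A -> N, g 0 = 0 &
      forall x y, f x y = g y - g (x + y) + g x >].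

Lemma B2_zmod_closed : zmod_closed B2.
Proof.
split=> [|f f' /asboolP[g g0 fg] /asboolP[g' g'0 fg']]; apply/asboolP.
  by exists 0 => // x y; rewrite Z20E -[RHS]/(0 - 0 + 0 : N); zmod.
exists (g - g'); first by rewrite !fctE g0 g'0 subrr.
by move=> x y; rewrite Z2BE !fctE fg fg'; zmod.
Qed.
HB.instance Definition _ := GRing.isZmodClosed.Build Z2 B2 B2_zmod_closed.

(* Cochains are normalized in both [Z2] and [B2]. *)
Definition H2 := Quotient.quot B2.

End GroupCohomology.

Section SymmetricCohomology.
Variables A M : zmodType.

Definition is_Z2ab (f : A -> A -> M) : Prop :=
  (forall x y, f x y = f y x) /\
  (forall x y z, f y z - f (x + y) z + f x (y + z) - f x y = 0).

Definition Z2ab_pred : {pred A -> A -> M} := fun f => `[< is_Z2ab f >].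

Lemma Z2ab_pred_zmod_closed : zmod_closed Z2ab_pred.
Proof.
split=> [|f g /asboolP[sf cf] /asboolP[sg cg]]; apply/asboolP; split=> /=.
- by [].
- by move=> x y z; rewrite -[LHS]/(0 - 0 + 0 - 0 : M); zmod.
- by move=> x y; rewrite !fctE sf sg.
- move=> x y z; rewrite !fctE -[RHS](subrr 0) -{1}(cf x y z) -(cg x y z).
  by zmod.
Qed.
HB.instance Definition _ :=
  GRing.isZmodClosed.Build (A -> A -> M) Z2ab_pred Z2ab_pred_zmod_closed.

Record Z2ab := MkZ2ab {
  Z2ab_fun :> A -> A -> M; Z2abP : Z2ab_fun \in Z2ab_pred }.
HB.instance Definition _ := [isSub for Z2ab_fun].
HB.instance Definition _ := [Choice of Z2ab by <:].
HB.instance Definition _ := [SubChoice_isSubZmodule of Z2ab by <:].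

Lemma Z2ab0E x y : (0 : Z2ab) x y = 0.
Proof. by rewrite -[Z2ab_fun _]/(val _) raddf0. Qed.

Lemma Z2abBE (f g : Z2ab) x y : (f - g) x y = f x y - g x y.
Proof. by rewrite -[Z2ab_fun _]/(val _) raddfB. Qed.

Definition B2ab : {pred Z2ab} := fun f =>
  `[< exists l : A -> M, forall x y, f x y = l y - l (x + y) + l x >].

Lemma B2ab_zmod_closed : zmod_closed B2ab.
Proof.
split=> [|f f' /asboolP[g fg] /asboolP[g' fg']]; apply/asboolP.
  by exists 0 => x y; rewrite Z2ab0E -[RHS]/(0 - 0 + 0 : M); zmod.
by exists (g - g') => x y; rewrite Z2abBE !fctE fg fg'; zmod.
Qed.
HB.instance Definition _ := GRing.isZmodClosed.Build Z2ab B2ab B2ab_zmod_closed.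

(* [H2ab] is the factor-set model of Ext^1_Z(A, M): symmetric 2-cocycles, not
   required to be normalized, modulo the coboundaries of arbitrary maps. *)
Definition H2ab := Quotient.quot B2ab.

End SymmetricCohomology.

Section Hom.
Variables A N : zmodType.
Implicit Types f g h : {additive A -> N}.

HB.instance Definition _ := gen_eqMixin {additive A -> N}.
HB.instance Definition _ := gen_choiceMixin {additive A -> N}.

Lemma hom_ext f g : f =1 g -> f = g.
Proof.
case: f g => [f [[f1]]] [g [[g1]]] /= /funext fg.
by case: _ / fg g1 => g1; rewrite (Prop_irrelevance f1 g1).
Qed.

Definition hom0 : {additive A -> N} := \0.
Definition hom_opp f : {additive A -> N} := \- f.
Definition hom_add f g : {additive A -> N} := f \+ g.

Lemma hom_addA : associative hom_add.
Proof. by move=> f g h; apply: hom_ext => x /=; rewrite addrA. Qed.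
Lemma hom_addC : commutative hom_add.
Proof. by move=> f g; apply: hom_ext => x /=; rewrite addrC. Qed.
Lemma hom_add0 : left_id hom0 hom_add.
Proof. by move=> f; apply: hom_ext => x /=; rewrite add0r. Qed.
Lemma hom_addN : left_inverse hom0 hom_opp hom_add.
Proof. by move=> f; apply: hom_ext => x /=; rewrite addNr. Qed.
HB.instance Definition _ := GRing.isZmodule.Build {additive A -> N}
  hom_addA hom_addC hom_add0 hom_addN.

Lemma hom0E x : (0 : {additive A -> N}) x = 0. Proof. by []. Qed.
Lemma homDE f g x : (f + g) x = f x + g x. Proof. by []. Qed.
Lemma homNE f x : (- f) x = - f x. Proof. by []. Qed.

End Hom.

Section Obstruction.
Variables A N : zmodType.
Implicit Types (w : A -> A -> A -> N) (eta : A -> A -> N).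

Definition alpha w x y z : N := w x y z - w y x z + w y z x.
Definition beta w x y z : N := w x y z - w x z y + w z x y.

Definition Z3ab (p : (A -> A -> A -> N) * (A -> A -> N)) : Prop :=
  let: (w, c) := p in
  forall x y z t,
  [/\ w y z t - w (x + y) z t + w x (y + z) t - w x y (z + t) + w x y z = 0,
      c x z - c x (y + z) + c x y + alpha w x y z = 0 &
      c y z - c (x + y) z + c x z - beta w x y z = 0].

Definition delta_h eta x y z : N := eta y z - eta (x + y) z + eta x z.
Definition delta_v eta x y z : N := eta x z - eta x (y + z) + eta x y.

Lemma alpha_Z2 (omega : Z3 A N) a : alpha omega a \in @Z2_pred A N.
Proof.
apply/asboolP; split=> [x|x y z]; rewrite /alpha.
  case: (Z3_norm omega a x) (Z3_norm omega x a) => -> -> -> [-> -> ->].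
  by split; zmod.
have D := Z3_cocycle omega.
have := D a x y z; have := D x a y z; have := D x y a z; have := D x y z a.
rewrite !(addrC _ a) => d1 d2 d3 d4.
have e : 0 = 0 - 0 + 0 - 0 :> N by zmod.
by rewrite [RHS]e -{1}d1 -{1}d2 -{1}d3 -{1}d4; zmod.
Qed.

Definition alpha_class (omega : Z3 A N) (a : A) : H2 A N :=
  \pi_(H2 A N) (MkZ2 (alpha_Z2 omega a)).

Lemma alpha_trivialP (omega : Z3 A N) : (forall a, alpha_class omega a = 0) ->
  exists eta, delta_v eta = alpha omega.
Proof.
move=> h; have g a : exists g : A -> N,
    forall x y, alpha omega a x y = g y - g (x + y) + g x.
  have := h a; rewrite /alpha_class -(raddf0 (\pi_(H2 A N))).
  move=> /eqP; rewrite -Quotient.idealrBE subr0 => /asboolP[g _ gE].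
  by exists g.
exists (fun a => projT1 (cid (g a))); apply/funext => a; apply/funext => x.
by apply/funext => y; rewrite /delta_v; case: cid.
Qed.

Definition theta_fun w eta x y z : N := delta_h eta x y z + beta w x y z.

Section Theta.
Variables (omega : Z3 A N) (eta : A -> A -> N).
Hypothesis etaE : delta_v eta = alpha omega.

Let ev x y z : eta x z - eta x (y + z) + eta x y = alpha omega x y z.
Proof. by rewrite -etaE. Qed.

Lemma theta_funD x y z t :
  theta_fun omega eta x y (z + t) =
  theta_fun omega eta x y z + theta_fun omega eta x y t.
Proof.
have D := Z3_cocycle omega.
have := ev (x + y) z t; have := ev y z t; have := ev x z t.
have := D z t x y; have := D z x t y; have := D x z t y.
have := D z x y t; have := D x z y t; have := D x y z t.
rewrite (addrC z x) (addrC z y) (addrC t x) (addrC t y).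
move=> d1 d2 d3 d4 d5 d6 /eqP + /eqP + /eqP.
rewrite -!(subr_eq0 _ (alpha _ _ _ _)) => /eqP e1 /eqP e2 /eqP e3.
apply/eqP; rewrite -subr_eq0; apply/eqP.
have e0 : 0 = - 0 + 0 - 0 - 0 + 0 - 0 - 0 - 0 + 0 :> N by zmod.
rewrite [RHS]e0 -{1}d1 -{1}d2 -{1}d3 -{1}d4 -{1}d5 -{1}d6 -{1}e1 -{1}e2 -{1}e3.
by rewrite /theta_fun /delta_h /beta /alpha; zmod.
Qed.

Lemma theta_fun_additive x y : zmod_morphism (theta_fun omega eta x y).
Proof.
by move=> z t; rewrite -[in RHS](subrK t z) [in RHS]theta_funD addrK.
Qed.

HB.instance Definition _ x y := GRing.isZmodMorphism.Build A N
  (theta_fun omega eta x y) (theta_fun_additive x y).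

Definition theta_hom x y : {additive A -> N} := theta_fun omega eta x y.

Lemma theta_hom_Z2ab : theta_hom \in @Z2ab_pred A {additive A -> N}.
Proof.
apply/asboolP; split=> [x y|x y z]; apply: hom_ext => t.
  apply/eqP; rewrite -subr_eq0 /theta_hom /= /theta_fun /delta_h.
  have := ev x y t; have := ev x t y.
  rewrite (addrC t y) (addrC y x) => /eqP + /eqP.
  rewrite -!(subr_eq0 _ (alpha _ _ _ _)) => /eqP e1 /eqP e2.
  have e0 : 0 = 0 - 0 :> N by zmod.
  by rewrite [X in _ == X]e0 -{1}e1 -{1}e2 /alpha /beta; apply/eqP; zmod.
rewrite homDE homNE homDE homDE homNE hom0E /theta_hom /= /theta_fun /delta_h.
have D := Z3_cocycle omega.
have := D t x y z; have := D x t y z; have := D x y t z; have := D x y z t.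
rewrite !(addrC t) !addrA => d1 d2 d3 d4.
have e0 : 0 = 0 - 0 + 0 - 0 :> N by zmod.
by rewrite [RHS]e0 -{1}d1 -{1}d2 -{1}d3 -{1}d4 /beta !addrA; zmod.
Qed.

Definition theta_cocycle : Z2ab A {additive A -> N} := MkZ2ab theta_hom_Z2ab.

Definition theta_class : H2ab A {additive A -> N} :=
  \pi_(H2ab A {additive A -> N}) theta_cocycle.

End Theta.

(* The witness [eta] is picked by choice; [thetaE] below shows that the class
   is independent of it. *)
Definition theta (omega : Z3 A N) (h : forall a, alpha_class omega a = 0) :
    H2ab A {additive A -> N} :=
  theta_class (projT2 (cid (alpha_trivialP h))).

Lemma thetaE (omega : Z3 A N) (h : forall a, alpha_class omega a = 0) eta
    (etaE : delta_v eta = alpha omega) : @theta omega h = theta_class etaE.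
Proof.
rewrite /theta; case: cid => eta' eta'E /=.
have lD x : zmod_morphism (fun z => eta' x z - eta x z).
  move=> y z /=; have := congr1 (fun f => f x (y - z) z) (etrans eta'E (esym etaE)).
  rewrite /delta_v subrK => /eqP; rewrite -subr_eq0 => /eqP e.
  by rewrite -[RHS]addr0 -e; zmod.
pose lm x := GRing.isZmodMorphism.Build A N _ (lD x).
pose l x : {additive A -> N} := HB.pack (fun z => eta' x z - eta x z) (lm x).
apply/eqP; rewrite /theta_class -Quotient.idealrBE; apply/asboolP.
exists l => x y; apply: hom_ext => z; rewrite Z2abBE.
rewrite !(homDE, homNE) /= /theta_hom /= /theta_fun /delta_h.
by zmod.
Qed.

End Obstruction.

Arguments theta {A N} omega h.

(* Main.v *)
(* Up to the sign [eta = - c], condition (ii) says [delta_v eta = alpha] and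
   condition (iii) says that the cocycle theta(omega, eta) vanishes. Changing
   [eta] by a family of homomorphisms [l] keeps the first equation and changes
   the cocycle by the coboundary of [l], so it can be made to vanish exactly
   when its class is zero. *)
Require Import Defs.
From mathcomp Require Import all_boot all_algebra.
From mathcomp Require Import ring_quotient boolp.

Local Open Scope ring_scope.

Import GRing.Theory.

(** Turns vanishing in the quotient into an identity between values in [N], the form that can be
    compared with condition (iii). *)
Lemma theta_class_eq0P (A N : zmodType) (omega : Z3 A N) (eta : A -> A -> N)
    (etaE : delta_v eta = alpha omega) :
  theta_class etaE = 0 <->
  exists l : A -> {additive A -> N}, forall x y z,
    theta_fun omega eta x y z = l y z - l (x + y) z + l x z.
Proof.
rewrite /theta_class -(raddf0 (\pi_(H2ab A {additive A -> N})%qT)).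
split=> [/eqP|[l lE]].
  rewrite -Quotient.idealrBE subr0 => /asboolP[l lE].
  by exists l => x y z; rewrite -[LHS]/(theta_hom etaE x y z) [theta_hom _ _ _]lE.
apply/eqP; rewrite -Quotient.idealrBE subr0; apply/asboolP; exists l => x y.
by apply: hom_ext => z; rewrite !(homDE, homNE) -lE.
Qed.

Theorem corollary4p14 (A N : zmodType) (omega : Z3 A N)
    (h : forall a : A, alpha_class omega a = 0) :
  (exists c : A -> A -> N, Z3ab ((omega : A -> A -> A -> N), c)) <->
  theta omega h = 0.
Proof.
split=> [[c cE]|].
  have etaE : delta_v (fun x y => - c x y) = alpha omega.
    apply/funext => x; apply/funext => y; apply/funext => z.
    have [_ e _] := cE x y z 0.
    by rewrite -[RHS]subr0 -e /delta_v; zmod.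
  rewrite (thetaE h etaE); apply/theta_class_eq0P.
  exists (fun=> 0) => x y z; have [_ _ e] := cE x y z 0.
  have -> : theta_fun omega (fun x y => - c x y) x y z =
      - (c y z - c (x + y) z + c x z - beta omega x y z).
    by rewrite /theta_fun /delta_h; zmod.
  by rewrite e hom0E; zmod.
have [eta etaE] := alpha_trivialP h.
rewrite (thetaE h etaE) => /theta_class_eq0P[l lE].
(* Each [l x] is additive, so [delta_v] kills it and (ii) reduces to [etaE]. *)
exists (fun x y => l x y - eta x y) => x y z t; split.
- exact: Z3_cocycle.
- by rewrite -etaE /delta_v (raddfD (l x)); zmod.
(* Only the second copy of [theta_fun] becomes the coboundary of [l]; the first, unfolded, accounts
   for [delta_h eta] and [beta]. *)
- have e0 : 0 = - (theta_fun omega eta x y z - theta_fun omega eta x y z).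
    by rewrite subrr oppr0.
  by rewrite [RHS]e0 {2}lE /theta_fun /delta_h; zmod.
Qed.
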